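(* Let $0\le\gamma\le\pi/2$ and let $\Omega=|\Omega\rangle\langle\Omega|$ be the density operator of the two-qubit pure state $$|\Omega\rangle=\cos\left(\tfrac{\pi}{4}-\tfrac{\gamma}{2}\right)|\uparrow\uparrow\rangle+\sin\left(\tfrac{\pi}{4}-\tfrac{\gamma}{2}\right)|\downarrow\downarrow\rangle .$$ Let $\mathcal{T}$ be the $U\otimes U^*$ twirling map. Then the (minimum) error rates of the key generated from $\Omega$ and from $\mathcal{T}(\Omega)$ satisfy $$\delta_{\min}(\mathcal{T}(\Omega))=\frac{2}{3}\,\delta_{\min}(\Omega).$$
   Context: $|\uparrow\rangle,|\downarrow\rangle$ is a fixed orthonormal basis of $\mathbb{C}^2$, $\mathbb{I}$ is the $2\times 2$ identity, and $\sigma_1=|\uparrow\rangle\langle\downarrow|+|\downarrow\rangle\langle\uparrow|$, $\sigma_2=-i|\uparrow\rangle\langle\downarrow|+i|\downarrow\rangle\langle\uparrow|$, $\sigma_3=|\uparrow\rangle\langle\uparrow|-|\downarrow\rangle\langle\downarrow|$ are the Pauli matrices. For a unit vector $\boldsymbol n\in\mathbb{R}^3$, $\sigma_{\boldsymbol n}=n_1\sigma_1+n_2\sigma_2+n_3\sigma_3$. A two-qubit state is a positive semidefinite, trace-one operator on $\mathbb{C}^2\otimes\mathbb{C}^2$. All states considered have the form $$\rho=\tfrac14\Big(\mathbb{I}\otimes\mathbb{I}+x_3\,\sigma_3\otimes\mathbb{I}+y_3\,\mathbb{I}\otimes\sigma_3+\sum_{i,j=1}^3T_{ij}\,\sigma_i\otimes\sigma_j\Big),\qquad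 T_{ij}=\mathrm{Tr}[\rho(\sigma_i\otimes\sigma_j)]$$ (both $\Omega$ and $\mathcal{T}(\Omega)$ are of this form). Error rate. Let $\boldsymbol x=(1,0,0)$ and $\boldsymbol y=(0,1,0)$. For unit vectors $\boldsymbol a,\boldsymbol b\in\mathbb{R}^3$ write $\langle\boldsymbol a\otimes\boldsymbol b\rangle=\mathrm{Tr}[\rho(\sigma_{\boldsymbol a}\otimes\sigma_{\boldsymbol b})]$. The probability that the outcomes ($\pm1$) of measuring $\sigma_{\boldsymbol a}$ on the first qubit and $\sigma_{\boldsymbol b}$ on the second qubit differ is $(1-\langle\boldsymbol a\otimes\boldsymbol b\rangle)/2$. The error rate of the key for settings $\boldsymbol b,\boldsymbol b'$ on the second qubit is the average of these probabilities for the joint measurements $\sigma_{\boldsymbol x}\otimes\sigma_{\boldsymbol b}$ and $\sigma_{\boldsymbol y}\otimes\sigma_{\boldsymbol b'}$, i.e. $\frac12-\frac14\big(\langle\boldsymbol x\otimes\boldsymbol b\rangle+\langle\boldsymbol y\otimes\boldsymbol b'\rangle\big)$, and $\delta_{\min}(\rho)$ is its minimum over all unit vectors $\boldsymbol b,\boldsymbol b'\in\mathbb{R}^3$. Twirling. $\mathcal{T}(\rho)=\int_{SU(2)}(U\otimes U^* )\,\rho\,(U\otimes U^* )^\dagger\,dU$, where $dU$ is normalized Haar measure and $U^*$ is the entrywise complex conjugate of $U$ in the basis $|\uparrow\rangle,|\downarrow\rangle$. *)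

(* Defs.v *)
From HB Require Import structures.
From mathcomp Require Import all_boot all_order all_algebra.
From mathcomp Require Import sesquilinear spectral.
From mathcomp Require Import all_classical all_reals all_analysis.
From mathcomp Require Import complex mxtens.
From mathcomp Require Import ring lra.
Import Order.TTheory GRing.Theory Num.Theory numFieldNormedType.Exports.
Set Implicit Arguments.
Unset Strict Implicit.
Unset Printing Implicit Defensive.
Local Open Scope classical_set_scope.
Local Open Scope ring_scope.
Local Open Scope complex_scope.
Local Open Scope sesquilinear_scope.

Section Qubits.
Variable R : realType.
Local Notation C := (R[i] : numClosedFieldType).

Definition ket_up : 'cV[C]_2 := delta_mx 0 0.
Definition ket_down : 'cV[C]_2 := delta_mx 1 0.

Definition sigma1 : 'M[C]_2 := ket_up *m ket_down^t* + ket_down *m ket_up^t*.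
Definition sigma2 : 'M[C]_2 :=
  - ('i)%C *: (ket_up *m ket_down^t*) + ('i)%C *: (ket_down *m ket_up^t*).
Definition sigma3 : 'M[C]_2 := ket_up *m ket_up^t* - ket_down *m ket_down^t*.

Definition sigma_dir (n : 'rV[R]_3) : 'M[C]_2 :=
  (n 0 0)%:C *: sigma1 + (n 0 1)%:C *: sigma2 + (n 0 2)%:C *: sigma3.

(* Euclidean norm 1: the library norm on matrices is the sup norm. *)
Definition unit_vector (n : 'rV[R]_3) : Prop := \sum_i n 0 i ^+ 2 = 1.

Definition xdir : 'rV[R]_3 := delta_mx 0 0.
Definition ydir : 'rV[R]_3 := delta_mx 0 1.

(* The trace is real when rho is Hermitian; Re only serves to view it in R. *)
Definition correlation (rho : 'M[C]_(2 * 2)) (a b : 'rV[R]_3) : R :=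
  complex.Re (\tr (rho *m (sigma_dir a *t sigma_dir b))).

Definition prob_differ (rho : 'M[C]_(2 * 2)) (a b : 'rV[R]_3) : R :=
  (1 - correlation rho a b) / 2.

Definition error_rate (rho : 'M[C]_(2 * 2)) (b b' : 'rV[R]_3) : R :=
  (prob_differ rho xdir b + prob_differ rho ydir b') / 2.

Lemma correlation_linear (rho : 'M[C]_(2 * 2)) (a : 'rV[R]_3) :
  exists t : 'I_3 -> R, forall b, correlation rho a b = \sum_i b 0 i * t i.
Proof.
pose s (i : 'I_3) := nth 0 [:: sigma1; sigma2; sigma3] i.
exists (fun i => complex.Re (\tr (rho *m (sigma_dir a *t s i)))) => b.
have sdE : sigma_dir b = \sum_i (b 0 i)%:C *: s i.
  rewrite !big_ord_recl big_ord0 addr0 addrA /sigma_dir /s /=.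
  by congr (_ *: _ + _ *: _ + _ *: _); congr (_%:C); congr (b _ _); apply/val_inj.
have tensE : sigma_dir a *t sigma_dir b = \sum_i (b 0 i)%:C *: (sigma_dir a *t s i).
  apply/matrixP => k l; rewrite mxE sdE !summxE mulr_sumr.
  by apply: eq_bigr => i _; rewrite !mxE mulrCA.
rewrite /correlation tensE mulmx_sumr [\tr _]raddf_sum raddf_sum /=.
apply: eq_bigr => i _; rewrite -scalemxAr linearZ /=.
by case: (\tr _) => u v /=; rewrite mul0r subr0.
Qed.

Lemma linear_max (t : 'I_3 -> R) : exists2 b : 'rV[R]_3, unit_vector b &
  forall b', unit_vector b' -> \sum_i b' 0 i * t i <= \sum_i b 0 i * t i.
Proof.
pose T := \sum_i t i ^+ 2.
have T_ge0 : 0 <= T by apply: sumr_ge0 => i _; exact: sqr_ge0.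
have [T0|Tn0] := eqVneq T 0.
  have t0 i : t i = 0.
    apply/eqP; rewrite -sqrf_eq0; apply/eqP.
    by move: T0 => /eqP; rewrite psumr_eq0 => [/allP/(_ i (mem_index_enum _))/eqP|j _];
      [exact | exact: sqr_ge0].
  exists xdir.
    rewrite /unit_vector /xdir !big_ord_recl big_ord0 !mxE /=.
    by rewrite expr1n !expr0n !addr0.
  by move=> b' _; rewrite !big1 // => i _; rewrite t0 mulr0.
pose q := Num.sqrt T.
have q2 : q ^+ 2 = T by rewrite sqr_sqrtr.
have q_gt0 : 0 < q by rewrite sqrtr_gt0 lt_neqAle eq_sym Tn0.
have sumE (b : 'rV[R]_3) : (forall i, b 0 i = t i / q) -> \sum_i b 0 i * t i = q.
  move=> bE; under eq_bigr => i _ do rewrite bE mulrAC -expr2.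
  by rewrite -mulr_suml -/T -q2 expr2 mulfK // gt_eqF.
exists (\row_i (t i / q)).
  rewrite /unit_vector; under eq_bigr => i _ do rewrite mxE expr_div_n.
  by rewrite -mulr_suml -/T q2 divff.
move=> b' b'1; rewrite [leRHS]sumE; last by move=> i; rewrite mxE.
have : 0 <= \sum_i (t i - q * b' 0 i) ^+ 2 by apply: sumr_ge0 => i _; exact: sqr_ge0.
have -> : \sum_i (t i - q * b' 0 i) ^+ 2
   = T + q ^+ 2 * (\sum_i b' 0 i ^+ 2) - (2 * q) * \sum_i b' 0 i * t i.
  rewrite /T !mulr_sumr -big_split /= -sumrB.
  by apply: eq_bigr => i _; ring.
rewrite b'1 -q2 mulr1 => h.
have : 0 <= (2 * q) * (q - \sum_i b' 0 i * t i) by move: h; congr (_ <= _); ring.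
by rewrite pmulr_rge0 ?subr_ge0 // mulr_gt0.
Qed.

Lemma error_rate_min (rho : 'M[C]_(2 * 2)) : exists c c' : 'rV[R]_3,
  [/\ unit_vector c, unit_vector c' &
   forall b b', unit_vector b -> unit_vector b' ->
     error_rate rho c c' <= error_rate rho b b'].
Proof.
have [t tE] := correlation_linear rho xdir; have [t' t'E] := correlation_linear rho ydir.
have [c c1 cP] := linear_max t; have [c' c'1 c'P] := linear_max t'.
exists c, c'; split=> // b b' b1 b'1.
rewrite /error_rate /prob_differ !tE !t'E.
by move: (cP _ b1) (c'P _ b'1); lra.
Qed.

(* The infimum in delta_min is a minimum, as the next two lemmas show. *)
Definition delta_min (rho : 'M[C]_(2 * 2)) : R :=
  inf [set error_rate rho b b' | b in unit_vector & b' in unit_vector].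

Lemma delta_min_attained (rho : 'M[C]_(2 * 2)) : exists b b' : 'rV[R]_3,
  [/\ unit_vector b, unit_vector b' & delta_min rho = error_rate rho b b'].
Proof.
have [c [c' [c1 c'1 cP]]] := error_rate_min rho; exists c, c'; split=> //.
apply/eqP; rewrite eq_le; apply/andP; split.
  apply: ge_inf; last by exists c => //; exists c'.
  by exists (error_rate rho c c') => _ [b b1 [b' b'1 <-]]; exact: cP.
apply: lb_le_inf; first by exists (error_rate rho c c'), c => //; exists c'.
by move=> _ [b b1 [b' b'1 <-]]; exact: cP.
Qed.

Lemma delta_min_le (rho : 'M[C]_(2 * 2)) (b b' : 'rV[R]_3) :
  unit_vector b -> unit_vector b' -> delta_min rho <= error_rate rho b b'.
Proof.
move=> b1 b'1; apply: ge_inf; last by exists b => //; exists b'.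
have [c [c' [_ _ cP]]] := error_rate_min rho.
by exists (error_rate rho c c') => _ [d d1 [d' d'1 <-]]; exact: cP.
Qed.

Definition Omega_ket (gamma : R) : 'cV[C]_(2 * 2) :=
  (cos (pi / 4 - gamma / 2))%:C *: (ket_up *t ket_up)
  + (sin (pi / 4 - gamma / 2))%:C *: (ket_down *t ket_down).

Definition Omega (gamma : R) : 'M[C]_(2 * 2) :=
  Omega_ket gamma *m (Omega_ket gamma)^t*.

Definition is_SU2 (U : 'M[C]_2) : bool := (U \is unitarymx) && (\det U == 1).

Definition SU2 := {U : 'M[C]_2 | is_SU2 U}.

Lemma is_SU2_1 : is_SU2 1%:M.
Proof. by rewrite /is_SU2 det1 eqxx andbT; apply/unitarymxP; rewrite trmx1 map_mx1 mul1mx. Qed.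

Lemma is_SU2_mul (U V : SU2) : is_SU2 (val U *m val V).
Proof.
case: U V => [U /= /andP[Uu /eqP dU]] [V /= /andP[Vu /eqP dV]].
by rewrite /is_SU2 det_mulmx dU dV mulr1 eqxx andbT mul_unitarymx.
Qed.

Definition SU2_one : SU2 := exist _ 1%:M is_SU2_1.
Definition SU2_mul (U V : SU2) : SU2 := exist _ (val U *m val V) (is_SU2_mul U V).

HB.instance Definition _ := Choice.on SU2.
HB.instance Definition _ := isPointed.Build SU2 SU2_one.
(* subspace topology *)
HB.instance Definition _ := Topological.copy SU2
  (initial_topology (val : SU2 -> 'M[R[i] : numFieldType]_2)).

Definition SU2_borel := g_sigma_algebraType (open : set (set SU2)).

(* The normalized Haar measure: the translation-invariant Borel probability.
   (Left invariance suffices: SU(2) is compact, hence unimodular.) *)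
Definition is_haar (mu : probability SU2_borel R) : Prop :=
  forall (V : SU2) (A : set SU2_borel), measurable A ->
    mu (SU2_mul V @^-1` A) = mu A.

Definition integral_C (mu : probability SU2_borel R) (f : SU2 -> C) : C :=
  Rintegral mu setT (fun U => complex.Re (f U))
  +i* Rintegral mu setT (fun U => complex.Im (f U)).

Definition twirl_unitary (U : SU2) : 'M[C]_(2 * 2) :=
  val U *t map_mx Num.conj (val U).

Definition twirl (mu : probability SU2_borel R) (rho : 'M[C]_(2 * 2)) :
    'M[C]_(2 * 2) :=
  \matrix_(i, j) integral_C mu
    (fun U => (twirl_unitary U *m rho *m (twirl_unitary U)^t*) i j).

End Qubits.

(* Main.v *)
Require Import Defs.
From mathcomp Require Import all_boot all_order all_algebra.
From mathcomp Require Import sesquilinear spectral.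
From mathcomp Require Import all_classical all_reals all_analysis.
From mathcomp Require Import measurable_realfun.
From mathcomp Require Import complex mxtens.
From mathcomp Require Import ring lra.
Import Order.TTheory GRing.Theory Num.Theory numFieldNormedType.Exports.
Set Implicit Arguments.
Unset Strict Implicit.
Unset Printing Implicit Defensive.
Local Open Scope classical_set_scope.
Local Open Scope ring_scope.
Local Open Scope sesquilinear_scope.

(* By invariance of the Haar measure, M = T(rho) is fixed by conjugation with
   V (x) V^* for every V in SU(2).  Half-turns about coordinate axes then kill
   the correlations T_12, T_13, T_21, T_23 of M, and a cyclic permutation of the
   axes gives T_11 = - T_22 = T_33.  The operator
   K = s1 (x) s1 - s2 (x) s2 + s3 (x) s3 commutes with every U (x) U^*, because
   K + 1 = 2 |b><b| where b = |00> + |11> is fixed by U (x) U^*; hence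
   Tr(M K) = Tr(rho K).  So 3 T_11 = Tr(Omega K) = 1 + 4 c s with c, s the
   Schmidt coefficients of Omega.  When T_11 = - T_22 = t >= 0 and T_12, T_13,
   T_21, T_23 vanish, delta_min is (1 - t) / 2; here t = 2 c s for Omega and
   t = (1 + 4 c s) / 3 for its twirl. *)

(** * Algebra of Kronecker products *)

Section TensorProduct.

Lemma sum_mxtens_index (V : nmodType) m n (F : 'I_(m * n) -> V) :
  \sum_k F k = \sum_i \sum_j F (mxtens_index (i, j)).
Proof.
rewrite pair_bigA /= (reindex (@mxtens_index m n)); last first.
  by exists (@mxtens_unindex m n) => k _; rewrite (mxtens_indexK, mxtens_unindexK).
by apply: eq_bigr => -[].
Qed.

Lemma tensmx_mul (R : comPzRingType) m n p q r s (A : 'M[R]_(m, n))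
    (B : 'M[R]_(p, q)) (A' : 'M[R]_(n, r)) (B' : 'M[R]_(q, s)) :
  (A *t B) *m (A' *t B') = (A *m A') *t (B *m B').
Proof.
apply/matrixP => k l; rewrite !mxE sum_mxtens_index mulr_suml.
apply: eq_bigr => i _; rewrite mulr_sumr; apply: eq_bigr => j _.
by rewrite !mxE !mxtens_indexK mulrACA.
Qed.

Lemma tensmxDr (R : comPzRingType) m n p q (A : 'M[R]_(m, n)) (B B' : 'M[R]_(p, q)) :
  A *t (B + B') = A *t B + A *t B'.
Proof. by apply/matrixP => k l; rewrite !mxE mulrDr. Qed.

Lemma tensmxZr (R : comPzRingType) m n p q c (A : 'M[R]_(m, n)) (B : 'M[R]_(p, q)) :
  A *t (c *: B) = c *: (A *t B).
Proof. by apply/matrixP => k l; rewrite !mxE mulrCA. Qed.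

Lemma tensmxNr (R : comPzRingType) m n p q (A : 'M[R]_(m, n)) (B : 'M[R]_(p, q)) :
  A *t (- B) = - (A *t B).
Proof. by apply/matrixP => k l; rewrite !mxE mulrN. Qed.

End TensorProduct.

(** * Two-by-two matrices, Pauli matrices and the operator K *)

Section PauliAlgebra.
Variable C : numClosedFieldType.
Implicit Types (A B U V : 'M[C]_2) (M : 'M[C]_(2 * 2)).

Definition mx2 (a b c d : C) : 'M[C]_2 := \matrix_(i, j)
  if i == 0 then (if j == 0 then a else b) else (if j == 0 then c else d).

Lemma ord2P (P : 'I_2 -> Prop) : P 0 -> P 1 -> forall i, P i.
Proof.
move=> P0 P1 [[|[|//]] i2].
  by have -> : Ordinal i2 = 0 by exact: val_inj.
by have -> : Ordinal i2 = 1 by exact: val_inj.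
Qed.

Lemma sum_ord2 (V : nmodType) (F : 'I_2 -> V) : \sum_i F i = F 0 + F 1.
Proof.
by rewrite !big_ord_recl big_ord0 addr0; congr (_ + F _); exact: val_inj.
Qed.

Lemma mx2P A B : A 0 0 = B 0 0 -> A 0 1 = B 0 1 -> A 1 0 = B 1 0 ->
  A 1 1 = B 1 1 -> A = B.
Proof.
by move=> h00 h01 h10 h11; apply/matrixP => i j; move: i j; do 2!apply: ord2P.
Qed.

Lemma mul_mx2 a b c d a' b' c' d' : mx2 a b c d *m mx2 a' b' c' d' =
  mx2 (a * a' + b * c') (a * b' + b * d') (c * a' + d * c') (c * b' + d * d').
Proof. by apply: mx2P; rewrite !mxE sum_ord2 !mxE. Qed.

Lemma opp_mx2 a b c d : - mx2 a b c d = mx2 (- a) (- b) (- c) (- d).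
Proof. by apply: mx2P; rewrite !mxE. Qed.

Lemma trmx_mx2 a b c d : (mx2 a b c d)^T = mx2 a c b d.
Proof. by apply: mx2P; rewrite !mxE. Qed.

Lemma map_mx2 (f : C -> C) a b c d :
  map_mx f (mx2 a b c d) = mx2 (f a) (f b) (f c) (f d).
Proof. by apply: mx2P; rewrite !mxE. Qed.

Lemma one_mx2 : 1%:M = mx2 1 0 0 1.
Proof. by apply: mx2P; rewrite !mxE. Qed.

Lemma det_mx2 a b c d : \det (mx2 a b c d) = a * d - b * c.
Proof.
rewrite (expand_det_row _ 0) sum_ord2 /cofactor !mxE /=.
rewrite [row' _ (col' 0 _)]mx11_scalar [row' _ (col' 1 _)]mx11_scalar.
by rewrite !det_scalar1 !mxE /= expr0 expr1 mul1r mulN1r mulrN.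
Qed.

Lemma mulCii : 'i * 'i = -1 :> C. Proof. by rewrite -expr2 sqrCi. Qed.

Definition pauli1 := mx2 0 1 1 0.
Definition pauli2 := mx2 0 (- 'i) 'i 0.
Definition pauli3 := mx2 1 0 0 (-1).

Definition twirl_mx U : 'M[C]_(2 * 2) := U *t map_mx Num.conj U.

Lemma adjmx_twirl U : (twirl_mx U)^t* = (U^t*) *t (U^T).
Proof.
rewrite /twirl_mx trmx_tens map_mxT; congr (_ *t _).
by apply/matrixP => i j; rewrite !mxE /= conjCK.
Qed.

(** The unnormalized maximally entangled vector |00> + |11>. *)
Definition bell_vec : 'cV[C]_(2 * 2) :=
  \col_k ((mxtens_unindex k).1 == (mxtens_unindex k).2)%:R.

(** The coordinate of the left side at the pair (p, q) is the sum over i of U_pi times the conjugate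
    of U_qi, that is, the entry (p, q) of U U^t* = 1. *)
Lemma twirl_bell U : U \is unitarymx -> twirl_mx U *m bell_vec = bell_vec.
Proof.
move=> /unitarymxP /matrixP Uu; apply/matrixP => k j.
rewrite !mxE sum_mxtens_index; have := Uu (mxtens_unindex k).1 (mxtens_unindex k).2.
rewrite !mxE => <-; apply: eq_bigr => i _.
rewrite (bigD1 i) //= !mxE !mxtens_indexK /= eqxx mulr1 big1 ?addr0 // => l.
by rewrite eq_sym !mxE mxtens_indexK /= => /negPf ->; rewrite mulr0.
Qed.

(** This is the sum of s_i (x) s_i^T over the three Pauli matrices; the minus sign comes from s_2^T
    = - s_2. *)
Definition isotropic_obs : 'M[C]_(2 * 2) :=
  pauli1 *t pauli1 - pauli2 *t pauli2 + pauli3 *t pauli3.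

Lemma isotropic_obsE : isotropic_obs = 2 *: (bell_vec *m bell_vec^t*) - 1%:M.
Proof.
apply/matrixP => k l; case: (mxtens_indexP k) => i i'; case: (mxtens_indexP l) => j j'.
rewrite !mxE big_ord1 !mxE !mxtens_indexK (inj_eq (can_inj (@mxtens_indexK 2 2))).
rewrite rmorph_nat xpair_eqE.
by move: i i' j j'; do 4!apply: ord2P;
  rewrite /= ?(mulr0, mul0r, mulrN, mulNr, mulr1, mul1r) ?mulCii
    ?(subr0, addr0, add0r, opprK, sub0r, subrr) //; ring.
Qed.

(** Write W = U (x) U^* and b = [bell_vec]. Since W^t* W = 1, the equation W b = b also gives W^t* b
    = b and b^t* W = b^t*, so conjugation fixes both terms of 2 b b^t* - 1. *)
Lemma twirl_isotropic U : U \is unitarymx ->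
  (twirl_mx U)^t* *m isotropic_obs *m twirl_mx U = isotropic_obs.
Proof.
move=> Uu; have WW : (twirl_mx U)^t* *m twirl_mx U = 1%:M.
  rewrite adjmx_twirl tensmx_mul.
  have /unitarymxP/mulmx1C UU := Uu.
  rewrite UU; have -> : U^T *m map_mx Num.conj U = 1%:M.
    have := congr1 (map_mx Num.conj) UU; rewrite map_mxM map_mx1 => <-.
    by congr (_ *m _); apply/matrixP => i j; rewrite !mxE /= conjCK.
  apply/matrixP => k l; case: (mxtens_indexP k) => i i'.
  case: (mxtens_indexP l) => j j'.
  rewrite tensmxE !mxE (inj_eq (can_inj (@mxtens_indexK 2 2))) xpair_eqE.
  by rewrite -natrM mulnb.
have Wb : (twirl_mx U)^t* *m bell_vec = bell_vec.
  by rewrite -{1}(twirl_bell Uu) mulmxA WW mul1mx.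
have bW : bell_vec^t* *m twirl_mx U = bell_vec^t*.
  have := congr1 (fun X => X^t*) Wb.
  by rewrite trmx_mul map_mxM -map_trmx trmxK map_mxCK.
rewrite isotropic_obsE mulmxBr mulmxBl mulmx1 WW -scalemxAr -scalemxAl.
by rewrite mulmxA Wb -mulmxA bW.
Qed.

(** * Special unitary matrices acting on the Pauli axes *)

Definition special_unitary V := (V \is unitarymx) && (\det V == 1).

(* Conjugation by the first two is a half-turn about a coordinate axis; the
   third permutes the three axes cyclically. *)
Definition flip1 := mx2 0 'i 'i 0.
Definition flip2 := mx2 0 1 (-1) 0.
Definition cycle3 := mx2 ((1 - 'i) / 2) ((-1 - 'i) / 2) ((1 - 'i) / 2) ((1 + 'i) / 2).

Let mx2E := (trmx_mx2, map_mx2, mul_mx2, one_mx2, det_mx2, opp_mx2).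

Let conjE :=
  (rmorphM, rmorphD, rmorphB, rmorphN, fmorphV, rmorph0, rmorph1, rmorph_nat).

Lemma special_unitary_flip1 : special_unitary flip1.
Proof.
apply/andP; split; last by rewrite det_mx2 mulCii mul0r sub0r opprK.
by apply/unitarymxP; rewrite !mx2E /= conjCi rmorph0; congr mx2; ring: mulCii.
Qed.

Lemma special_unitary_flip2 : special_unitary flip2.
Proof.
apply/andP; split; last by rewrite det_mx2 mul0r mul1r sub0r opprK.
by apply/unitarymxP; rewrite !mx2E /= !conjE; congr mx2; ring.
Qed.

Lemma special_unitary_cycle3 : special_unitary cycle3.
Proof.
apply/andP; split; last by rewrite det_mx2; apply/eqP; field: mulCii.
apply/unitarymxP; rewrite !mx2E /= !conjE /= !conjCi.
by congr mx2; field: mulCii.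
Qed.

Lemma tens_conj_twirl V A B : (twirl_mx V)^t* *m (A *t B) *m twirl_mx V =
  (V^t* *m A *m V) *t (V^T *m B *m map_mx Num.conj V).
Proof. by rewrite adjmx_twirl /twirl_mx !tensmx_mul. Qed.

Let conjugate := (adjmx_twirl, tens_conj_twirl, trmx_mx2, map_mx2, mul_mx2, opp_mx2).

(** Here [flip1] is i s_1 and its entrywise conjugate is - i s_1, so both qubits undergo the
    half-turn about the first axis. *)
Lemma twirl_flip1 : [/\ flip1^t* *m pauli1 *m flip1 = pauli1,
  flip1^T *m pauli2 *m map_mx Num.conj flip1 = - pauli2 &
  flip1^T *m pauli3 *m map_mx Num.conj flip1 = - pauli3].
Proof.
by split; rewrite !conjugate /= ?conjCi ?rmorph0; congr mx2; ring: mulCii.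
Qed.

Lemma twirl_flip2 : [/\ flip2^t* *m pauli2 *m flip2 = pauli2,
  flip2^T *m pauli1 *m map_mx Num.conj flip2 = - pauli1 &
  flip2^T *m pauli3 *m map_mx Num.conj flip2 = - pauli3].
Proof.
by split; rewrite !conjugate /= !conjE ?conjCi; congr mx2; ring: mulCii.
Qed.

(** On the second qubit V^T B V^* is the transpose of V^t* B^T V. The matrix s_2 is antisymmetric
    while s_1 and s_3 are symmetric, hence the sign in the last equation and later in T_22 = -
    T_11. *)
Lemma twirl_cycle3 : [/\ cycle3^t* *m pauli1 *m cycle3 = pauli3,
  cycle3^T *m pauli1 *m map_mx Num.conj cycle3 = pauli3,
  cycle3^t* *m pauli2 *m cycle3 = pauli1 &
  cycle3^T *m pauli2 *m map_mx Num.conj cycle3 = - pauli1].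
Proof. by split; rewrite !conjugate /= !conjE /= ?conjCi; congr mx2; field: mulCii. Qed.

(** * Correlations of an operator invariant under every V (x) V^* *)

Section Invariant.
Variable M : 'M[C]_(2 * 2).
Hypothesis twirlM : forall V, special_unitary V ->
  twirl_mx V *m M *m (twirl_mx V)^t* = M.

(** Cyclicity of the trace moves the conjugation from M to the observable. *)
Lemma mxtrace_invariant V A B : special_unitary V ->
  \tr (M *m (A *t B)) =
  \tr (M *m ((V^t* *m A *m V) *t (V^T *m B *m map_mx Num.conj V))).
Proof.
move=> /twirlM MV; rewrite -{1}MV -mulmxA mxtrace_mulC -tens_conj_twirl.
by rewrite [RHS]mxtrace_mulC !mulmxA.
Qed.

(** Invariance makes the trace equal to its own opposite. *)
Lemma mxtrace_invariant0 V A B : special_unitary V ->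
  V^t* *m A *m V = A -> V^T *m B *m map_mx Num.conj V = - B ->
  \tr (M *m (A *t B)) = 0.
Proof.
move=> Vsu VA VB; have := mxtrace_invariant A B Vsu.
rewrite VA VB tensmxNr mulmxN linearN /= => /eqP.
by rewrite -subr_eq0 opprK -mulr2n mulrn_eq0 /= => /eqP.
Qed.

Lemma invariant_correlations :
  [/\ \tr (M *m (pauli1 *t pauli2)) = 0, \tr (M *m (pauli1 *t pauli3)) = 0,
      \tr (M *m (pauli2 *t pauli1)) = 0 & \tr (M *m (pauli2 *t pauli3)) = 0].
Proof.
have [f11 f12 f13] := twirl_flip1; have [f22 f21 f23] := twirl_flip2.
split.
- exact: mxtrace_invariant0 special_unitary_flip1 f11 f12.
- exact: mxtrace_invariant0 special_unitary_flip1 f11 f13.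
- exact: mxtrace_invariant0 special_unitary_flip2 f22 f21.
- exact: mxtrace_invariant0 special_unitary_flip2 f22 f23.
Qed.

(** The cyclic permutation of the axes makes the three terms of K, signs included, contribute
    equally to Tr(M K). *)
Lemma invariant_correlation_diag :
  \tr (M *m (pauli1 *t pauli1)) = \tr (M *m isotropic_obs) / 3 /\
  \tr (M *m (pauli2 *t pauli2)) = - (\tr (M *m isotropic_obs) / 3).
Proof.
have [c11 c11' c22 c22'] := twirl_cycle3.
have e13 := mxtrace_invariant pauli1 pauli1 special_unitary_cycle3.
have e21 := mxtrace_invariant pauli2 pauli2 special_unitary_cycle3.
rewrite c11 c11' in e13; rewrite c22 c22' tensmxNr mulmxN linearN /= in e21.
rewrite /isotropic_obs mulmxDr mulmxBr linearD linearB /= -e13 e21.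
by split; field.
Qed.

End Invariant.

(** The trace is the expectation k^t* (A (x) B) k. As k is supported on |00> and |11>, only four
    entries of A (x) B contribute, and real coefficients remove the conjugations. *)
Lemma mxtrace_schmidt (c s : C) A B :
  let e0 : 'cV[C]_2 := delta_mx 0 0 in let e1 : 'cV[C]_2 := delta_mx 1 0 in
  let k : 'cV[C]_(2 * 2) := c *: (e0 *t e0) + s *: (e1 *t e1) in
  c^* = c -> s^* = s ->
  \tr (k *m k^t* *m (A *t B)) = c ^+ 2 * (A 0 0 * B 0 0)
    + c * s * (A 0 1 * B 0 1 + A 1 0 * B 1 0) + s ^+ 2 * (A 1 1 * B 1 1).
Proof.
move=> e0 e1 k cr sr; rewrite -mulmxA mxtrace_mulC /mxtrace big_ord1.
have kE i j : k (mxtens_index (i, j)) 0 = if i == j then (if i == 0 then c else s) else 0.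
  (* A tensor product of columns has its column index in ['I_(1 * 1)], so 0 must be read as an
     encoded pair. *)
  rewrite (_ : 0 = mxtens_index (0, 0) :> 'I_(1 * 1)); last exact: val_inj.
  rewrite !mxE !mxtens_indexK /=; move: i j; do 2!apply: ord2P;
  by rewrite /= ?(mulr0, mulr1, mul0r, addr0, add0r).
clearbody k; rewrite mxE sum_mxtens_index !sum_ord2 !kE /= !mulr0 addr0 add0r.
rewrite !mxE !sum_mxtens_index !sum_ord2 !mxE !mxtens_indexK !kE /=.
by rewrite cr sr !rmorph0; ring.
Qed.

Lemma ket_bra (i j : 'I_2) :
  (delta_mx i 0 : 'cV[C]_2) *m (delta_mx j 0 : 'cV[C]_2)^t* = delta_mx i j.
Proof. by rewrite trmx_delta map_delta_mx mul_delta_mx. Qed.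

Definition pauli_dir (x y z : C) := x *: pauli1 + y *: pauli2 + z *: pauli3.

Lemma mxtrace_pauli M A (x y z : C) :
  \tr (M *m (A *t pauli_dir x y z)) =
  x * \tr (M *m (A *t pauli1)) + y * \tr (M *m (A *t pauli2)) +
  z * \tr (M *m (A *t pauli3)).
Proof. by rewrite /pauli_dir !tensmxDr !tensmxZr !mulmxDr -!scalemxAr !linearD /= !linearZ. Qed.

Lemma pauli1_ket : delta_mx 0 1 + delta_mx 1 0 = pauli1.
Proof. by apply: mx2P; rewrite !mxE /= ?addr0 ?add0r. Qed.

Lemma pauli2_ket : - 'i *: delta_mx 0 1 + 'i *: delta_mx 1 0 = pauli2.
Proof. by apply: mx2P; rewrite !mxE /= ?(mulr0, mulr1, addr0, add0r). Qed.

Lemma pauli3_ket : delta_mx 0 0 - delta_mx 1 1 = pauli3.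
Proof. by apply: mx2P; rewrite !mxE /= ?(subr0, sub0r, oppr0). Qed.

(** The hypothesis is the formula of [mxtrace_schmidt]. The summand c^2 + s^2 is T_33; it is
    evaluated later, over the reals, as cos^2 + sin^2. *)
Lemma schmidt_correlations M (c s : C) :
  (forall A B, \tr (M *m (A *t B)) = c ^+ 2 * (A 0 0 * B 0 0)
    + c * s * (A 0 1 * B 0 1 + A 1 0 * B 1 0) + s ^+ 2 * (A 1 1 * B 1 1)) ->
  [/\ [/\ \tr (M *m (pauli1 *t pauli2)) = 0, \tr (M *m (pauli1 *t pauli3)) = 0,
          \tr (M *m (pauli2 *t pauli1)) = 0 & \tr (M *m (pauli2 *t pauli3)) = 0],
      \tr (M *m (pauli1 *t pauli1)) = 2 * (c * s),
      \tr (M *m (pauli2 *t pauli2)) = - (2 * (c * s)) &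
      \tr (M *m isotropic_obs) = 4 * (c * s) + (c ^+ 2 + s ^+ 2)].
Proof.
move=> ME; have e11 : \tr (M *m (pauli1 *t pauli1)) = 2 * (c * s).
  by rewrite ME !mxE /=; ring.
have e22 : \tr (M *m (pauli2 *t pauli2)) = - (2 * (c * s)).
  by rewrite ME !mxE /=; ring: mulCii.
split=> //; first by split; rewrite ME !mxE /=; ring.
rewrite /isotropic_obs mulmxDr mulmxBr linearD linearB /= e11 e22 ME !mxE /=; ring.
Qed.

End PauliAlgebra.

(** * Real and imaginary parts: products, bounds, continuity *)

Section ComplexParts.
Variable R : realType.
Implicit Types x y : R[i].

Lemma complex_ReM x y :
  complex.Re (x * y) = complex.Re x * complex.Re y - complex.Im x * complex.Im y.
Proof. by case: x; case: y. Qed.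

Lemma complex_ImM x y :
  complex.Im (x * y) = complex.Re x * complex.Im y + complex.Im x * complex.Re y.
Proof. by case: x; case: y. Qed.

Lemma normr_Re_le x (e : R) : `|x| <= e%:C%C -> `|complex.Re x| <= e.
Proof. by move=> xe; rewrite -lecR (le_trans (normc_ge_Re x)). Qed.

Lemma normr_Im_le x (e : R) : `|x| <= e%:C%C -> `|complex.Im x| <= e.
Proof.
(* Multiplication by i keeps the modulus and turns - Im x into a real part. *)
move=> xe; rewrite -normrN -ReiNIm; apply: normr_Re_le.
by rewrite normrM (_ : `|('i)%C| = 1) ?mulr1 // normc_def /= expr0n add0r expr1n sqrtr1.
Qed.

Lemma continuous_Re : continuous (@complex.Re R : (R[i] : numFieldType) -> R).
Proof.
move=> z; apply/(@cvgrPdist_le _ _ _ _ (nbhs_filter z)) => e e0.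
have e0' : 0 < e%:C%C by rewrite ltcR.
near=> w; rewrite -raddfB; apply/normr_Re_le/ltW.
by near: w; exact: nbhsx_ballx.
Unshelve. all: by end_near. Qed.

Lemma continuous_Im : continuous (@complex.Im R : (R[i] : numFieldType) -> R).
Proof.
move=> z; apply/(@cvgrPdist_le _ _ _ _ (nbhs_filter z)) => e e0.
have e0' : 0 < e%:C%C by rewrite ltcR.
near=> w; rewrite -raddfB; apply/normr_Im_le/ltW.
by near: w; exact: nbhsx_ballx.
Unshelve. all: by end_near. Qed.

End ComplexParts.

(** * Bounded measurable functions, real and complex *)

Section BoundedMeasurable.
Context d (T : measurableType d) (R : realType).
Implicit Types (f g : T -> R) (u v : T -> R[i]).

(** This class is closed under sums and products and is integrable for every probability, so it
    settles all integrability side conditions below. *)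
Definition bounded_mfun f :=
  measurable_fun [set: T] f /\ exists M, forall x, `|f x| <= M.

Lemma bounded_mfun_cst c : bounded_mfun (fun=> c).
Proof. by split; [exact: measurable_cst | exists `|c|]. Qed.

Lemma bounded_mfunD f g : bounded_mfun f -> bounded_mfun g ->
  bounded_mfun (fun x => f x + g x).
Proof.
move=> [mf [M fM]] [mg [N gN]]; split; first exact: measurable_funD.
by exists (M + N) => x; rewrite (le_trans (ler_normD _ _)) // lerD.
Qed.

Lemma bounded_mfunN f : bounded_mfun f -> bounded_mfun (fun x => - f x).
Proof.
move=> [mf [M fM]]; split; first exact: measurableT_comp.
by exists M => x; rewrite normrN.
Qed.

Lemma bounded_mfunM f g : bounded_mfun f -> bounded_mfun g ->
  bounded_mfun (fun x => f x * g x).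
Proof.
move=> [mf [M fM]] [mg [N gN]]; split; first exact: measurable_funM.
by exists (M * N) => x; rewrite normrM ler_pM.
Qed.

Definition bounded_mfunC u :=
  bounded_mfun (fun x => complex.Re (u x)) /\ bounded_mfun (fun x => complex.Im (u x)).

Lemma bounded_mfunC_cst c : bounded_mfunC (fun=> c).
Proof. by split; exact: bounded_mfun_cst. Qed.

Lemma bounded_mfunCD u v : bounded_mfunC u -> bounded_mfunC v ->
  bounded_mfunC (fun x => u x + v x).
Proof.
by move=> [ru iu] [rv iv]; split; under eq_fun do rewrite raddfD; exact: bounded_mfunD.
Qed.

Lemma bounded_mfunCM u v : bounded_mfunC u -> bounded_mfunC v ->
  bounded_mfunC (fun x => u x * v x).
Proof.
move=> [ru iu] [rv iv]; split.
  under eq_fun do rewrite complex_ReM.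
  by apply: bounded_mfunD; [|apply: bounded_mfunN]; exact: bounded_mfunM.
under eq_fun do rewrite complex_ImM.
by apply: bounded_mfunD; exact: bounded_mfunM.
Qed.

Lemma bounded_mfunC_conj u : bounded_mfunC u -> bounded_mfunC (fun x => (u x)^*%C).
Proof.
move=> [ru iu]; split.
  by rewrite (_ : (fun x => _) = fun x => complex.Re (u x)) //; apply/funext => x; case: (u x).
rewrite (_ : (fun x => _) = fun x => - complex.Im (u x)); first exact: bounded_mfunN.
by apply/funext => x; case: (u x).
Qed.

Lemma bounded_mfunC_sum (I : finType) (u : I -> T -> R[i]) :
  (forall i, bounded_mfunC (u i)) -> bounded_mfunC (fun x => \sum_i u i x).
Proof.
move=> bu; elim: (index_enum I) => [|i s IHs].
  by under eq_fun do rewrite big_nil; exact: bounded_mfunC_cst.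
by under eq_fun do rewrite big_cons; exact: bounded_mfunCD.
Qed.

Lemma bounded_mfun_integrable (mu : probability T R) f :
  bounded_mfun f -> mu.-integrable setT (EFin \o f).
Proof.
move=> [mf [M fM]]; apply: measurable_bounded_integrable => //.
  by apply: le_lt_trans (probability_le1 mu measurableT) (ltry 1).
by exists M; split=> [|N MN x _ /=]; [exact: num_real | exact: le_trans (fM x) (ltW MN)].
Qed.

End BoundedMeasurable.

(** * Continuity and measurability on SU(2) *)

Section SU2Functions.
Variable R : realType.
Local Notation C := (R[i] : numClosedFieldType).
Local Notation K := (R[i] : numFieldType).
Local Notation SU2 := (SU2 R).
Local Notation G := (SU2_borel R).

Lemma continuous_SU2_coord i j :
  continuous (fun U : SU2 => val U i j : K).
Proof.
move=> U; apply: (@continuous_comp SU2 'M[K]_2 K val (fun A => A i j)).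
  exact: initial_continuous.
exact: coord_continuous.
Qed.

Lemma continuous_SU2_mul (V : SU2) : continuous (SU2_mul V).
Proof.
(* The topology of [SU2] is initial for [val], so continuity is tested in the matrix space, where a
   neighbourhood contains a box of entrywise neighbourhoods P i j. *)
apply: continuous_comp_initial => U A [P VUP sPA].
suff: \forall W \near U, forall i j, P i j ((val V *m val W) i j).
  by apply: filterS => W PW; exact: sPA.
near=> W => i j; move: i j; near: W.
apply: filter_forall => i; apply: filter_forall => j.
have: (fun W : SU2 => (val V *m val W) i j : K) @ U --> (val V *m val U) i j.
  rewrite mxE sum_ord2; under eq_fun do rewrite mxE sum_ord2.
  (* Each entry of V W is a linear combination of two entries of W. *)
  have cW k := @cvgMl_tmp K _ _ (nbhs_filter U) _ (val V i k) _ (@continuous_SU2_coord k j U).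
  exact: (cvgD (cW 0) (cW 1)).
by apply; exact: VUP.
Unshelve. all: by end_near. Qed.

Lemma measurable_SU2_mul (V : SU2) : measurable_fun [set: G] (SU2_mul V : G -> G).
Proof.
apply: (@measurability _ _ G G setT (SU2_mul V) (open : set (set SU2)) erefl).
move=> _ [A oA <-]; rewrite setTI; apply: sub_sigma_algebra.
by move/continuousP: (@continuous_SU2_mul V); apply.
Qed.

Lemma measurable_SU2_continuous (f : SU2 -> R) :
  continuous f -> measurable_fun [set: G] (f : G -> R).
Proof.
move=> /continuousP cf; apply: (measurability _ (RGenOpens.measurableE R)) => //.
move=> _ [_ [a [b ->] <-]]; rewrite setTI; apply: sub_sigma_algebra.
exact/cf/interval_open.
Qed.

(** The squared moduli in a row of a unitary matrix sum to 1. *)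
Lemma norm_SU2_coord (U : SU2) i j : `|val U i j : C| <= 1.
Proof.
case: U => U /= /andP[/unitarymxP /matrixP /(_ i i)]; rewrite !mxE eqxx mulr1n => Ui _.
rewrite -(@expr_le1 _ 2) // -Ui (bigD1 j) //= !mxE /= normCK lerDl.
by apply: sumr_ge0 => k _; rewrite !mxE /= mul_conjC_ge0.
Qed.

Lemma bounded_SU2_coord i j :
  bounded_mfunC (fun U : G => val (U : SU2) i j : R[i]).
Proof.
split; split.
- apply: (@measurable_SU2_continuous (fun U => complex.Re (val U i j))) => U.
  by apply: continuous_comp; [exact: continuous_SU2_coord | exact: continuous_Re].
- by exists 1 => U; apply: normr_Re_le; exact: norm_SU2_coord.
- apply: (@measurable_SU2_continuous (fun U => complex.Im (val U i j))) => U.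
  by apply: continuous_comp; [exact: continuous_SU2_coord | exact: continuous_Im].
- by exists 1 => U; apply: normr_Im_le; exact: norm_SU2_coord.
Qed.

End SU2Functions.

(** * The complex integral: linearity and Haar invariance *)

Section HaarIntegral.
Variable R : realType.
Local Notation C := (R[i] : numClosedFieldType).
Local Notation SU2 := (SU2 R).
Local Notation G := (SU2_borel R).
Variable mu : probability G R.
Implicit Types (u v : G -> R[i]).

Lemma integral_C_cst (c : R[i]) : integral_C mu (fun=> c) = c.
Proof.
have cstE (r : R) : Rintegral mu setT (fun=> r) = r.
  rewrite Rintegral_cst // -[RHS]mulr1; congr (_ * _).
  by transitivity (fine (1%E : \bar R)); [congr fine; exact: probability_setT|].
by case: c => a b; congr (_ +i* _)%C; exact: cstE.
Qed.

Lemma integral_CD u v : bounded_mfunC u -> bounded_mfunC v ->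
  integral_C mu (fun U => u U + v U) = integral_C mu u + integral_C mu v.
Proof.
move=> [ru iu] [rv iv]; rewrite /integral_C.
under eq_Rintegral do rewrite raddfD /=.
rewrite RintegralD //; [|exact: bounded_mfun_integrable..].
congr (_ +i* _)%C; under eq_Rintegral do rewrite raddfD /=.
by rewrite RintegralD //; exact: bounded_mfun_integrable.
Qed.

Lemma integral_CZl (c : R[i]) u : bounded_mfunC u ->
  integral_C mu (fun U => c * u U) = c * integral_C mu u.
Proof.
move=> [ru iu]; have iru := bounded_mfun_integrable mu ru.
have iiu := bounded_mfun_integrable mu iu.
have bZ (r : R) f : bounded_mfun f -> mu.-integrable setT (EFin \o (fun U => r * f U)).
  by move=> bf; apply/bounded_mfun_integrable/bounded_mfunM => //; exact: bounded_mfun_cst.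
rewrite /integral_C; under eq_Rintegral do rewrite complex_ReM.
rewrite RintegralB // ?RintegralZl //; [|exact: bZ..].
under [X in (_ +i* X)%C]eq_Rintegral do rewrite complex_ImM.
rewrite RintegralD // ?RintegralZl //; [|exact: bZ..].
by case: c.
Qed.

Lemma integral_CZr (c : R[i]) u : bounded_mfunC u ->
  integral_C mu (fun U => u U * c) = integral_C mu u * c.
Proof.
by move=> bu; rewrite mulrC -integral_CZl //; congr integral_C; apply/funext => U; rewrite mulrC.
Qed.

Lemma integral_C_sum (I : finType) (u : I -> G -> R[i]) :
  (forall i, bounded_mfunC (u i)) ->
  integral_C mu (fun U => \sum_i u i U) = \sum_i integral_C mu (u i).
Proof.
(* Boundedness of the partial sum is carried along with its integral, since additivity at each step
   of the induction requires it. *)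
move=> bu; pose P v x := bounded_mfunC v /\ integral_C mu v = x.
suff [] : P (fun U => \sum_i u i U) (\sum_i integral_C mu (u i)) by [].
elim: (index_enum I) => [|i s [bs IHs]].
  rewrite big_nil; under eq_fun do rewrite big_nil.
  by split; [exact: bounded_mfunC_cst | exact: integral_C_cst].
rewrite big_cons; under eq_fun do rewrite big_cons.
by split; [exact: bounded_mfunCD | rewrite integral_CD // IHs].
Qed.

Hypothesis haar_mu : is_haar mu.

(** By change of variables the left side is the integral of f against the image of [mu] under U -> V
    U, and this image agrees with [mu] on measurable sets. *)
Lemma Rintegral_SU2_mul (V : SU2) (f : G -> R) : bounded_mfun f ->
  Rintegral mu setT (fun U => f (SU2_mul V U)) = Rintegral mu setT f.
Proof.
move=> bf; have mV := measurable_SU2_mul V; have [mf [M fM]] := bf.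
have bfV : bounded_mfun (fun U : G => f (SU2_mul V U)).
  by split; [exact: (measurableT_comp mf mV) | exists M].
congr fine; have iV := bounded_mfun_integrable mu bfV.
have mfE : measurable_fun setT (EFin \o f) by exact/measurable_EFinP.
have /= <- := integral_pushforward mV mfE iV measurableT.
by apply: eq_measure_integral => A mA _; exact: haar_mu.
Qed.

Lemma integral_C_SU2_mul (V : SU2) u : bounded_mfunC u ->
  integral_C mu (fun U => u (SU2_mul V U)) = integral_C mu u.
Proof.
move=> [ru iu]; rewrite /integral_C.
rewrite (Rintegral_SU2_mul V ru).
by rewrite (Rintegral_SU2_mul V iu).
Qed.

End HaarIntegral.

(** * The twirl: invariance and preserved expectations *)

Section Twirl.
Variable R : realType.
Local Notation C := (R[i] : numClosedFieldType).
Local Notation SU2 := (SU2 R).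
Local Notation G := (SU2_borel R).
Variables (mu : probability G R) (rho : 'M[C]_(2 * 2)).
Hypothesis haar_mu : is_haar mu.

Definition twirled (U : SU2) : 'M[C]_(2 * 2) :=
  twirl_mx (val U) *m rho *m (twirl_mx (val U))^t*.

(** The entries are polynomials in the entries of U and their conjugates. *)
Lemma bounded_twirled k l : bounded_mfunC (fun U : G => twirled U k l : R[i]).
Proof.
have bconj i j : bounded_mfunC (fun U : G => Num.conj (val (U : SU2) i j : C) : R[i]).
  exact: (bounded_mfunC_conj (bounded_SU2_coord R i j)).
have bW m n : bounded_mfunC (fun U : G => twirl_mx (val (U : SU2)) m n : R[i]).
  under eq_fun do rewrite !mxE /=.
  by apply: bounded_mfunCM; [exact: bounded_SU2_coord | exact: bconj].
under eq_fun do rewrite mxE; apply: bounded_mfunC_sum => n.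
apply: bounded_mfunCM.
  under eq_fun do rewrite mxE; apply: bounded_mfunC_sum => m.
  by apply: bounded_mfunCM; [exact: bW | exact: bounded_mfunC_cst].
rewrite (_ : (fun U => _) = (fun U : G => (twirl_mx (val (U : SU2)) l n : R[i])^*%C)).
  exact: bounded_mfunC_conj (bW _ _).
by apply/funext => U; rewrite !mxE.
Qed.

Lemma twirled_mul (V U : SU2) :
  twirled (SU2_mul V U) = twirl_mx (val V) *m twirled U *m (twirl_mx (val V))^t*.
Proof.
have WM : twirl_mx (val (SU2_mul V U)) = twirl_mx (val V) *m twirl_mx (val U) :> 'M[C]_(2 * 2).
  by rewrite /twirl_mx tensmx_mul map_mxM.
by rewrite /twirled WM trmx_mul map_mxM !mulmxA.
Qed.

Lemma twirlE k l : twirl mu rho k l = integral_C mu (fun U => twirled U k l).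
Proof. by rewrite mxE. Qed.

(** By linearity, conjugation by V (x) V^* passes under the integral, where it becomes the
    translation U -> V U that Haar measure ignores. *)
Lemma twirl_invariant (V : 'M[C]_2) : special_unitary V ->
  twirl_mx V *m twirl mu rho *m (twirl_mx V)^t* = twirl mu rho.
Proof.
move=> Vsu; pose V' : SU2 := exist _ V Vsu.
apply/matrixP => k l.
rewrite [RHS]twirlE -(integral_C_SU2_mul haar_mu V' (bounded_twirled k l)).
under [in RHS]eq_fun => U do rewrite twirled_mul mxE /=.
rewrite integral_C_sum; last first.
  move=> n; apply: bounded_mfunCM; last exact: bounded_mfunC_cst.
  under eq_fun do rewrite mxE; apply: bounded_mfunC_sum => m.
  by apply: bounded_mfunCM; [exact: bounded_mfunC_cst | exact: bounded_twirled].
rewrite mxE; apply: eq_bigr => n _.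
have bm m : bounded_mfunC (fun U : G => twirl_mx V k m * twirled U m n : R[i]).
  by apply: bounded_mfunCM; [exact: bounded_mfunC_cst | exact: bounded_twirled].
under [in RHS]eq_fun => U do rewrite mxE.
rewrite integral_CZr; last exact: bounded_mfunC_sum.
congr (_ * _); rewrite integral_C_sum // mxE; apply: eq_bigr => m _.
by rewrite integral_CZl ?twirlE //; exact: bounded_twirled.
Qed.

(** Since S is fixed by the conjugations, the integrand Tr([twirled] U S) is the constant Tr(rho S),
    and the measure has total mass 1. *)
Lemma mxtrace_twirl (S : 'M[C]_(2 * 2)) :
  (forall U : 'M[C]_2, U \is unitarymx -> (twirl_mx U)^t* *m S *m twirl_mx U = S) ->
  \tr (twirl mu rho *m S) = \tr (rho *m S).
Proof.
move=> S_inv.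
have trE (U : SU2) : \tr (twirled U *m S) = \tr (rho *m S).
  have /andP[Uu _] := valP U.
  by rewrite -[in RHS](S_inv _ Uu) /twirled -!mulmxA mxtrace_mulC !mulmxA.
rewrite -[RHS](integral_C_cst mu) -(_ : (fun U => \tr (twirled U *m S)) = fun=> _);
  last by apply/funext.
have bS k l : bounded_mfunC (fun U : G => twirled U k l * S l k : R[i]).
  by apply: bounded_mfunCM; [exact: bounded_twirled | exact: bounded_mfunC_cst].
rewrite /mxtrace integral_C_sum; last first.
  by move=> k; under eq_fun do rewrite mxE; exact: (bounded_mfunC_sum (bS k)).
apply: eq_bigr => k _; rewrite mxE; under [in RHS]eq_fun => U do rewrite mxE.
rewrite (integral_C_sum mu (bS k)); apply: eq_bigr => l _.
by rewrite integral_CZr ?twirlE //; exact: bounded_twirled.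
Qed.

End Twirl.

(** * Minimum error rates from Pauli correlations *)

Section ErrorRates.
Variable R : realType.
Local Notation C := (R[i] : numClosedFieldType).
Implicit Types (rho : 'M[C]_(2 * 2)) (a b : 'rV[R]_3).

Lemma sigma1E : sigma1 R = pauli1 C.
Proof. by rewrite -pauli1_ket -!ket_bra. Qed.

Lemma sigma2E : sigma2 R = pauli2 C.
Proof. by rewrite -pauli2_ket -!ket_bra. Qed.

Lemma sigma3E : sigma3 R = pauli3 C.
Proof. by rewrite -pauli3_ket -!ket_bra. Qed.

Lemma sigma_xdir : sigma_dir (xdir R) = pauli1 C.
Proof. by rewrite /sigma_dir !mxE /= !scale0r !addr0 scale1r sigma1E. Qed.

Lemma sigma_ydir : sigma_dir (ydir R) = pauli2 C.
Proof. by rewrite /sigma_dir !mxE /= !scale0r add0r addr0 scale1r sigma2E. Qed.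

Lemma sigma_dirE b :
  sigma_dir b = pauli_dir ((b 0 0)%:C%C : C) ((b 0 1)%:C%C : C) ((b 0 2)%:C%C : C).
Proof. by rewrite /pauli_dir -sigma1E -sigma2E -sigma3E. Qed.

Lemma correlationE rho a b (A : 'M[C]_2) (t1 t2 t3 : C) : sigma_dir a = A ->
  \tr (rho *m (A *t pauli1 C)) = t1 -> \tr (rho *m (A *t pauli2 C)) = t2 ->
  \tr (rho *m (A *t pauli3 C)) = t3 ->
  correlation rho a b =
  b 0 0 * complex.Re t1 + b 0 1 * complex.Re t2 + b 0 2 * complex.Re t3.
Proof.
move=> aA <- <- <-.
have ReZ (x y z : R) (u v w : C) :
    complex.Re ((x%:C%C : C) * u + (y%:C%C : C) * v + (z%:C%C : C) * w : C)
    = x * complex.Re u + y * complex.Re v + z * complex.Re w.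
  by case: u v w => [u u'] [v v'] [w w'] /=; rewrite !mul0r !subr0.
rewrite /correlation aA [sigma_dir b]sigma_dirE.
by rewrite -ReZ -(mxtrace_pauli rho).
Qed.

Lemma unit_vector_sqr b : unit_vector b <-> b 0 0 ^+ 2 + b 0 1 ^+ 2 + b 0 2 ^+ 2 = 1.
Proof.
rewrite /unit_vector !big_ord_recl big_ord0 addr0 addrA.
have -> : lift ord0 ord0 = 1 :> 'I_3 by exact: val_inj.
by have -> : lift ord0 (lift ord0 ord0) = 2 :> 'I_3 by exact: val_inj.
Qed.

Lemma delta_min_diag rho (t : R) : 0 <= t ->
  (forall b, correlation rho (xdir R) b = b 0 0 * t) ->
  (forall b, correlation rho (ydir R) b = - (b 0 1 * t)) ->
  delta_min rho = (1 - t) / 2.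
Proof.
move=> t0 xE yE; apply/eqP; rewrite eq_le; apply/andP; split.
  have x1 : unit_vector (xdir R).
    by apply/unit_vector_sqr; rewrite !mxE /= expr1n !expr0n !addr0.
  (* The optimal settings are b = x and b' = - y; the sign compensates T_22 = - t. *)
  have y1 : unit_vector (- ydir R).
    by apply/unit_vector_sqr; rewrite !mxE /= oppr0 sqrrN expr1n !expr0n addr0 add0r.
  apply: le_trans (delta_min_le rho x1 y1) _.
  by rewrite /error_rate /prob_differ xE yE !mxE /=; lra.
have [b [b' [/unit_vector_sqr b1 /unit_vector_sqr b'1 ->]]] := delta_min_attained rho.
(* Coordinates of a unit vector lie between -1 and 1, and t is nonnegative. *)
have bt : b 0 0 * t <= t by apply: ler_piMl => //; nra.
have b't : - (b' 0 1 * t) <= t by rewrite -mulNr; apply: ler_piMl => //; nra.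
by rewrite /error_rate /prob_differ xE yE; lra.
Qed.

Lemma delta_min_pauli rho (t : R) : 0 <= t ->
  [/\ \tr (rho *m (pauli1 C *t pauli2 C)) = 0, \tr (rho *m (pauli1 C *t pauli3 C)) = 0,
      \tr (rho *m (pauli2 C *t pauli1 C)) = 0 & \tr (rho *m (pauli2 C *t pauli3 C)) = 0] ->
  \tr (rho *m (pauli1 C *t pauli1 C)) = t%:C%C ->
  \tr (rho *m (pauli2 C *t pauli2 C)) = - t%:C%C ->
  delta_min rho = (1 - t) / 2.
Proof.
move=> t0 [z12 z13 z21 z23] e11 e22; apply: delta_min_diag => // b.
  by rewrite (correlationE b sigma_xdir e11 z12 z13) /= !mulr0 !addr0.
by rewrite (correlationE b sigma_ydir z21 e22 z23) /= !mulr0 add0r addr0 mulrN.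
Qed.

(** * Error rates of Omega and of its twirl *)

Section Omega.
Variable gamma : R.
Let c := cos (pi / 4 - gamma / 2).
Let s := sin (pi / 4 - gamma / 2).

Lemma mxtrace_Omega (A B : 'M[C]_2) : \tr (Omega gamma *m (A *t B)) =
  c%:C%C ^+ 2 * (A 0 0 * B 0 0) + c%:C%C * s%:C%C * (A 0 1 * B 0 1 + A 1 0 * B 1 0)
  + s%:C%C ^+ 2 * (A 1 1 * B 1 1).
Proof.
by apply: (@mxtrace_schmidt C); rewrite /= /Num.conj /= oppr0.
Qed.

Lemma delta_min_Omega : 0 <= 2 * (c * s) -> delta_min (Omega gamma) = (1 - 2 * (c * s)) / 2.
Proof.
move=> cs_ge0; have [z e11 e22 _] := schmidt_correlations mxtrace_Omega.
have csE : (2 * (c%:C%C * s%:C%C) : C) = (2 * (c * s))%:C%C by rewrite !rmorphM rmorph_nat.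
by rewrite csE in e11; rewrite csE in e22; exact: delta_min_pauli.
Qed.

Lemma delta_min_twirl_Omega (mu : probability (SU2_borel R) R) : is_haar mu ->
  0 <= 2 * (c * s) ->
  delta_min (twirl mu (Omega gamma)) = (1 - (4 * (c * s) + 1) / 3) / 2.
Proof.
move=> haar_mu cs_ge0; have [_ _ _ eK] := schmidt_correlations mxtrace_Omega.
have KE : (4 * (c%:C%C * s%:C%C) + (c%:C%C ^+ 2 + s%:C%C ^+ 2)) / 3
    = ((4 * (c * s) + 1) / 3)%:C%C :> C.
  have -> : 4 * (c * s) + 1 = 4 * (c * s) + (c ^+ 2 + s ^+ 2) by rewrite cos2Dsin2.
  (* The identity is proved for an arbitrary field morphism and then used for the embedding of the
     reals in the complex numbers. *)
  have fE (F K : fieldType) (f : {rmorphism F -> K}) x y :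
    (4 * (f x * f y) + (f x ^+ 2 + f y ^+ 2)) / 3 = f ((4 * (x * y) + (x ^+ 2 + y ^+ 2)) / 3).
    by rewrite fmorph_div rmorph_nat !rmorphD !rmorphXn !rmorphM rmorph_nat.
  exact: (fE R C (real_complex R)).
have inv := twirl_invariant (Omega gamma) haar_mu.
have [e11 e22] := invariant_correlation_diag inv.
have z := invariant_correlations inv.
have trK := mxtrace_twirl mu (Omega gamma) (@twirl_isotropic C).
rewrite trK eK KE in e11; rewrite trK eK KE in e22.
by apply: delta_min_pauli => //; lra.
Qed.

End Omega.
End ErrorRates.

Theorem mainTheorem1 (R : realType) (mu : probability (SU2_borel R) R)
    (haar_mu : is_haar mu) (gamma : R) (hgamma : 0 <= gamma <= pi / 2) :
  delta_min (twirl mu (Omega gamma)) = 2 / 3 * delta_min (Omega gamma).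
Proof.
have /andP[g0 g1] := hgamma; have pi0 := pi_gt0 R.
(* The bounds on [gamma] place the angle between 0 and pi / 4. *)
have cs_ge0 : 0 <= 2 * (cos (pi / 4 - gamma / 2) * sin (pi / 4 - gamma / 2)).
  apply: mulr_ge0 => //; apply: mulr_ge0.
    by apply: cos_ge0_pihalf; apply/andP; split; lra.
  by apply: sin_ge0_pi; apply/andP; split; lra.
(* With c and s the Schmidt coefficients, 1 - (4 c s + 1) / 3 = (2 / 3) (1 - 2 c s). *)
by rewrite delta_min_twirl_Omega // delta_min_Omega //; field.
Qed.
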